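(* Let $t \in T$ with $t \geq 10^6$, and suppose $P(t) = 1$. Then $C_3(t) > 5$.
   Context: For positive integers $m, r$, $C_m(r)$ is the minimum odd positive integer $n$ such that there exist vectors $v_1, \ldots, v_n \in \mathbb{Z}^m$ (not necessarily distinct) with $|v_i| = \sqrt{r}$ (Euclidean norm) for every $i$ and $v_1 + \cdots + v_n = \mathbf{0}$; if no such odd $n$ exists, $C_m(r) = 0$. $T$ is the set of positive integers $t \equiv 2 \pmod 4$ whose square-free part has at least one odd prime factor $p$ with $p \equiv 2 \pmod 3$. For a positive integer $z$, $P(z)$ is the number of integer triples $(a,b,c)$ with $0 \leq a \leq b \leq c$ and $a^2 + b^2 + c^2 = z$. *)

(* Defs.v *)
From mathcomp Require Import all_boot all_order all_algebra.
From mathcomp Require Import boolp.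
Set Implicit Arguments. Unset Strict Implicit. Unset Printing Implicit Defensive.
Import Order.TTheory GRing.Theory Num.Theory.

Definition zero_sum_config (m r n : nat) : Prop :=
  exists v : 'I_n -> 'I_m -> int,
    (forall i : 'I_n, (\sum_(j < m) (v i j) ^+ 2)%R = Posz r) /\
    (forall j : 'I_m, (\sum_(i < n) v i j)%R = 0%R).

Definition odd_config (m r : nat) : pred nat :=
  fun n => odd n && `[< zero_sum_config m r n >].

Definition C (m r : nat) : nat :=
  match pselect (exists n, odd_config m r n) with
  | left h => ex_minn h
  | right _ => 0
  end.

Definition sqfree_part (t : nat) : nat :=
  \prod_(p <- primes t | odd (logn p t)) p.

Definition inT (t : nat) : Prop :=
  0 < t /\ t %% 4 = 2 /\
  exists p, [/\ prime p, odd p, p %| sqfree_part t & p %% 3 = 2].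

Definition P (z : nat) : nat :=
  \sum_(c < z.+1) \sum_(b < c.+1) \sum_(a < b.+1)
     (a ^ 2 + b ^ 2 + c ^ 2 == z : nat).

(* Main.v *)
(** Since P(t) = 1, every vector of norm t is a signed permutation of one triple
    (a, b, c).  This triple is primitive: if an odd prime p divided it, rotating
    by an integer quaternion of norm p would yield a representation of t less
    divisible by p than (a, b, c).

    Sums of evenly many vectors then contain 2 Z^3, and
    (a, b, c) + (b, c, a) + (c, a, b) is a vector of equal even entries, so some
    odd number of vectors sums to zero.

    If n <= 5 vectors with n odd sum to zero, each coordinate gives a linear
    relation between a, b and c with coefficients at most 5 in absolute value.
    Two independent relations force (a, b, c) to divide their cross product,
    whose entries are at most 50, so t <= 7500.  Otherwise the coefficient matrix
    has rank one with odd row and column sums, all its entries are +-1, and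
    +-a +- b +- c = 0 gives t = 2 (a^2 + ab + b^2); a prime p = 2 mod 3 dividing
    this form divides a and b, against primitivity. *)

Require Import Defs.
From mathcomp Require Import all_boot all_order all_algebra.
From mathcomp Require Import perm finfield boolp zify ring.
Set Implicit Arguments. Unset Strict Implicit. Unset Printing Implicit Defensive.
Import Order.TTheory GRing.Theory Num.Theory.

(** * Representations as a sum of three squares *)

Definition unique_rep (t a b c : nat) : Prop :=
  forall a' b' c' : nat, a' <= b' <= c' -> a' ^ 2 + b' ^ 2 + c' ^ 2 = t ->
    [/\ a' = a, b' = b & c' = c].

Lemma sum_le1_inj (I : finType) (F : I -> nat) (i j : I) :
  \sum_k F k <= 1 -> 0 < F i -> 0 < F j -> i = j.
Proof.
move=> le1 Fi Fj; apply/eqP; apply: contraTT le1 => nij.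
by rewrite (bigD1 i) //= (bigD1 j) 1?eq_sym //=; lia.
Qed.

Lemma leq_term_sum (I : finType) (F : I -> nat) (i : I) : F i <= \sum_k F k.
Proof. by rewrite (bigD1 i) //= leq_addr. Qed.

Lemma sum_gt0_ex (I : finType) (F : I -> nat) :
  0 < \sum_k F k -> exists i, 0 < F i.
Proof.
rewrite lt0n sum_nat_eq0 negb_forall => /existsP[i].
by rewrite -lt0n; exists i.
Qed.

(** A sum of naturals equal to 1 has a single nonzero term. Applied to the outer sum this fixes [c],
    applied to the middle one it fixes [b], and then [a] is determined by its square. *)
Lemma P_eq1 (t : nat) : P t = 1 ->
  exists a b c : nat, a ^ 2 + b ^ 2 + c ^ 2 = t /\ unique_rep t a b c.
Proof.
move=> Pt.
pose F2 c b := \sum_(a < b.+1) (a ^ 2 + b ^ 2 + c ^ 2 == t : nat).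
pose F1 c := \sum_(b < c.+1) F2 c b.
have PE : P t = \sum_(c < t.+1) F1 c by [].
have F2gt0 a b c : a <= b -> a ^ 2 + b ^ 2 + c ^ 2 = t -> 0 < F2 c b.
  move=> ab e; apply: leq_trans (leq_term_sum _ (inord a)).
  by rewrite inordK ?ltnS // e eqxx.
have F1gt0 a b c : a <= b <= c -> a ^ 2 + b ^ 2 + c ^ 2 = t -> 0 < F1 c.
  move=> /andP[ab bc] e; apply: leq_trans (leq_term_sum _ (inord b)).
  by rewrite inordK ?ltnS // (F2gt0 a).
have [c0 /sum_gt0_ex [b0 /sum_gt0_ex [a0]]] : exists c : 'I_t.+1, 0 < F1 c.
  by apply: sum_gt0_ex; rewrite -PE Pt.
rewrite lt0b => /eqP e0.
have ab0 : a0 <= b0 by rewrite -ltnS ltn_ord.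
have bc0 : b0 <= c0 by rewrite -ltnS ltn_ord.
exists a0, b0, c0; split=> //.
move=> a b c /andP[ab bc] e.
have ct : c < t.+1 by nia.
have ec : Ordinal ct = c0.
  apply: (@sum_le1_inj _ (fun c : 'I_t.+1 => F1 c)); first by rewrite -PE Pt.
    by rewrite /= (F1gt0 a b) // ab.
  by rewrite (F1gt0 a0 b0) // ab0.
have {ct}{}ec : c = c0 by rewrite -ec.
subst c.
have le1 : F1 c0 <= 1 by rewrite -Pt PE (leq_term_sum (fun c : 'I_t.+1 => F1 c)).
have bl : b < c0.+1 by [].
have eb : Ordinal bl = b0.
  apply: (@sum_le1_inj _ (fun b : 'I_c0.+1 => F2 c0 b)) => //=.
    by rewrite (F2gt0 a).
  by rewrite (F2gt0 a0).
have {bl}{}eb : b = b0 by rewrite -eb.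
by subst b; split=> //; nia.
Qed.

(** * Odd primes as sums of four squares *)

(** Pigeonhole: for x, y <= (p - 1) / 2 the residues of x^2 are pairwise distinct, and so are those
    of -(y^2 + 1). Together these are p + 1 residues, so one of each kind must coincide. *)
Lemma dvdn_two_squares_add1 (p : nat) : prime p -> odd p ->
  exists x y : nat, [/\ x <= p./2, y <= p./2 & p %| x ^ 2 + y ^ 2 + 1].
Proof.
move=> p_pr p_odd; have p_gt0 := prime_gt0 p_pr.
have sq_neq (x y : nat) : x < y -> y <= p./2 -> y ^ 2 <> x ^ 2 %[mod p].
  move=> xy yp /eqP; rewrite eqn_mod_dvd; last by nia.
  rewrite subn_sqr Euclid_dvdM // => /orP[] /dvdn_leq; lia.
have sq_inj (x y : nat) : x <= p./2 -> y <= p./2 -> x ^ 2 = y ^ 2 %[mod p] -> x = y.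
  move=> xp yp exy; case: (ltngtP x y) => // lxy.
    by case: (sq_neq _ _ lxy yp).
  by case: (sq_neq _ _ lxy xp).
pose h := p./2.+1.
(* Adding [p ^ 2] represents -(y^2 + 1) by a natural number; the subtraction does not truncate
   because y <= p / 2. *)
pose f (u : 'I_h + 'I_h) : 'I_p :=
  Ordinal (ltn_pmod (match u with inl x => x ^ 2 | inr y => p ^ 2 - (y ^ 2 + 1) end) p_gt0).
have hx (x : 'I_h) : x <= p./2 by rewrite -ltnS ltn_ord.
have sqK (y : 'I_h) n : p ^ 2 - (y ^ 2 + 1) + (n + y ^ 2 + 1) = p * p + n.
  by have := hx y; nia.
have mixed (x y : 'I_h) : x ^ 2 = p ^ 2 - (y ^ 2 + 1) %[mod p] -> p %| x ^ 2 + y ^ 2 + 1.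
  move=> /eqP; rewrite -(eqn_modDr (0 + y ^ 2 + 1)) sqK.
  by rewrite addn0 modnMl add0n addnA.
have : ~~ injectiveb f.
  apply/negP => /injectiveP /leq_card.
  by rewrite card_sum !card_ord /h; lia.
case/injectivePn => -[x|x] [[y|y] nxy /(congr1 val) /= fxy].
- by move: nxy; rewrite (ord_inj (sq_inj _ _ (hx x) (hx y) fxy)) eqxx.
- by exists x, y; split; rewrite ?hx ?mixed.
- by exists y, x; split; rewrite ?hx ?mixed.
move: fxy => /eqP; rewrite -(eqn_modDr (y ^ 2 + x ^ 2 + 1)) sqK.
rewrite (addnC (y ^ 2) (x ^ 2)) sqK !modnMDl => /eqP /esym exy.
by move: nxy; rewrite (ord_inj (sq_inj _ _ (hx x) (hx y) exy)) eqxx.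
Qed.

Lemma centered_residue (m : nat) (x : int) : 0 < m ->
  exists y k : int, (x = y + m%:Z * k /\ - m%:Z <= 2 * y <= m%:Z)%R.
Proof.
move=> m0.
have [h|h] := lerP (2 * (x %% m%:Z)%Z)%R m%:Z.
  exists (x %% m%:Z)%Z, (x %/ m%:Z)%Z; lia.
exists ((x %% m%:Z)%Z - m%:Z)%R, ((x %/ m%:Z)%Z + 1)%R; lia.
Qed.

Local Open Scope ring_scope.

Lemma sqr_double_le (m y : int) : - m <= 2 * y <= m -> 4 * y ^+ 2 <= m ^+ 2.
Proof.
by move=> /andP[? ?]; rewrite -subr_ge0 (_ : _ - _ = (m - 2 * y) * (m + 2 * y)) ?mulr_ge0 //;
  [lia | lia | ring].
Qed.

Lemma sum4_sqr_eq0 (x y z w : int) : x ^+ 2 + y ^+ 2 + z ^+ 2 + w ^+ 2 = 0 ->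
  [/\ x = 0, y = 0, z = 0 & w = 0].
Proof.
move/eqP; rewrite !paddr_eq0 ?addr_ge0 ?sqr_ge0 // !sqrf_eq0.
by move=> /andP[/andP[/andP[/eqP-> /eqP->] /eqP->] /eqP->].
Qed.

Lemma sum4_le_max (a b c d M : int) :
  4 * a <= M -> 4 * b <= M -> 4 * c <= M -> 4 * d <= M ->
  a + b + c + d <= M /\
  (a + b + c + d = M -> [/\ 4 * a = M, 4 * b = M, 4 * c = M & 4 * d = M]).
Proof. by split; [|split]; lia. Qed.

Lemma half_of_sqr (m y : int) : 4 * y ^+ 2 = m ^+ 2 -> exists s : int, 2 * y = m * s.
Proof.
move=> ey; have /eqP : (2 * y - m) * (2 * y + m) = 0.
  by rewrite -subr_sqr -ey; ring.
by rewrite mulf_eq0 => /orP[] /eqP h; [exists 1 | exists (-1)]; lia.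
Qed.

(** Lagrange's descent: the centered residues modulo [m] have a sum of squares [m * r] with 0 < r <
    m, and Euler's four-square identity, divided by m^2, represents [r * p]. *)
Lemma prime_four_squares_descent (p m : nat) : prime p -> (0 < m < p)%N ->
  (exists x y z w : int, x ^+ 2 + y ^+ 2 + z ^+ 2 + w ^+ 2 = m%:Z * p%:Z) ->
  (exists x y z w : int, x ^+ 2 + y ^+ 2 + z ^+ 2 + w ^+ 2 = p%:Z).
Proof.
move=> p_pr; elim/ltn_ind: m => m IHm /andP[m_gt0 m_ltp] [x1 [x2 [x3 [x4 e]]]].
have [m1|m_neq1] := eqVneq m 1%N.
  by exists x1, x2, x3, x4; rewrite e m1 mul1r.
have m_ndvd (s : int) : p%:Z <> m%:Z * s.
  move=> ps; have : (m %| p)%N by rewrite (_ : (m %| p)%N = (m%:Z %| p%:Z)%Z) // ps dvdz_mulr.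
  by case/primeP: p_pr => _ /[apply]; lia.
have [y1 [k1 [e1 b1]]] := centered_residue x1 m_gt0.
have [y2 [k2 [e2 b2]]] := centered_residue x2 m_gt0.
have [y3 [k3 [e3 b3]]] := centered_residue x3 m_gt0.
have [y4 [k4 [e4 b4]]] := centered_residue x4 m_gt0.
have m_neq0 : m%:Z != 0 by lia.
(* Expanding x_i = y_i + m k_i in [e] gives this quotient by m of the sum of the y_i^2. *)
pose r : int := p%:Z - (2 * (y1 * k1 + y2 * k2 + y3 * k3 + y4 * k4)
   + m%:Z * (k1 ^+ 2 + k2 ^+ 2 + k3 ^+ 2 + k4 ^+ 2)).
have rE : y1 ^+ 2 + y2 ^+ 2 + y3 ^+ 2 + y4 ^+ 2 = m%:Z * r.
  by rewrite /r mulrBr -e e1 e2 e3 e4; ring.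
have [le_bound eq_bound] := sum4_le_max (sqr_double_le b1) (sqr_double_le b2)
  (sqr_double_le b3) (sqr_double_le b4).
have r_ge0 : 0 <= r.
  by rewrite -(@pmulr_rge0 _ m%:Z) // -rE ?addr_ge0 ?sqr_ge0.
have r_lem : r <= m%:Z.
  by rewrite -(@ler_pM2l _ m%:Z) // -rE -expr2.
(* If r = 0, all residues vanish, so m^2 divides m p and m divides p. *)
have r_neq0 : r != 0.
  apply/eqP => r0; rewrite r0 mulr0 in rE.
  have [z1 z2 z3 z4] := sum4_sqr_eq0 rE.
  apply: (m_ndvd (k1 ^+ 2 + k2 ^+ 2 + k3 ^+ 2 + k4 ^+ 2)).
  apply: (mulfI m_neq0); rewrite -e e1 e2 e3 e4 z1 z2 z3 z4; ring.
(* Equality r = m forces every residue to be +-m/2, and then m^2 divides m p. *)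
have r_neqm : r != m%:Z.
  apply/eqP => rm; rewrite rm -expr2 in rE.
  have [/half_of_sqr[s1 h1] /half_of_sqr[s2 h2] /half_of_sqr[s3 h3] /half_of_sqr[s4 h4]] :=
    eq_bound rE.
  apply: (m_ndvd (1 + (s1 * k1 + s2 * k2 + s3 * k3 + s4 * k4)
     + (k1 ^+ 2 + k2 ^+ 2 + k3 ^+ 2 + k4 ^+ 2))).
  rewrite !mulrDr !(mulrA m%:Z s1, mulrA m%:Z s2, mulrA m%:Z s3, mulrA m%:Z s4).
  rewrite -h1 -h2 -h3 -h4 mulr1 -[X in _ = X + _ + _]rm /r; ring.
have r_bound : (0 < `|r| < m)%N.
  by rewrite absz_gt0 r_neq0 -ltz_nat gez0_abs // lt_neqAle r_neqm.
case/andP: (r_bound) => r_gt0 r_ltm.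
apply: (IHm `|r|%N); rewrite // ?r_gt0 ?(ltn_trans r_ltm) //.
(* These are the components of the quaternion y times the conjugate of x, divided by m: with x = y +
   m k, the part from y alone contributes only m r, to the real component. *)
exists (r + (k1 * y1 + k2 * y2 + k3 * y3 + k4 * y4)),
  (k1 * y2 - k2 * y1 + k3 * y4 - k4 * y3),
  (k1 * y3 - k3 * y1 + k4 * y2 - k2 * y4),
  (k1 * y4 - k4 * y1 + k2 * y3 - k3 * y2).
rewrite gez0_abs //; apply: (mulfI (mulf_neq0 m_neq0 m_neq0)).
have -> : m%:Z * m%:Z * (r * p%:Z) = (m%:Z * r) * (m%:Z * p%:Z) by ring.
rewrite -[in RHS]rE -e.
transitivity ((m%:Z * r + m%:Z * (k1 * y1 + k2 * y2 + k3 * y3 + k4 * y4)) ^+ 2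
 + (m%:Z * (k1 * y2 - k2 * y1 + k3 * y4 - k4 * y3)) ^+ 2
 + (m%:Z * (k1 * y3 - k3 * y1 + k4 * y2 - k2 * y4)) ^+ 2
 + (m%:Z * (k1 * y4 - k4 * y1 + k2 * y3 - k3 * y2)) ^+ 2); first by ring.
rewrite -rE e1 e2 e3 e4; ring.
Qed.

Lemma prime_four_squares (p : nat) : prime p -> odd p ->
  exists x y z w : int, x ^+ 2 + y ^+ 2 + z ^+ 2 + w ^+ 2 = p%:Z.
Proof.
move=> p_pr p_odd.
have [x [y [xp yp /dvdnP[m em]]]] := dvdn_two_squares_add1 p_pr p_odd.
apply: (@prime_four_squares_descent p m) => //.
  (* Since x, y < p / 2, the sum x^2 + y^2 + 1 lies strictly between 0 and p^2, so 0 < m < p. *)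
  have p_gt1 := prime_gt1 p_pr.
  have [hx hy] : (2 * x < p /\ 2 * y < p)%N by lia.
  by apply/andP; split; nia.
by exists x%:Z, y%:Z, 1, 0; lia.
Qed.

(** * Rotation by quaternions and primitivity of the triple *)

Lemma dvdz_primeM (p : nat) (x y : int) : prime p ->
  (p%:Z %| x * y)%Z = (p%:Z %| x)%Z || (p%:Z %| y)%Z.
Proof. by move=> p_pr; rewrite !dvdzE abszM Euclid_dvdM. Qed.

Lemma ndvdz2 (p : nat) : prime p -> odd p -> ~~ (p%:Z %| 2)%Z.
Proof.
move=> p_pr p_odd; rewrite dvdzE /= dvdn_prime2 //.
by apply: contraTneq p_odd => ->.
Qed.

(* Conjugation by an integer quaternion of norm p multiplies norms by p^2.  If
   for each coordinate i it mapped into p Z^3 two permutations of (u, v, w)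
   differing by the sign of an entry u at position i, the diagonal of its
   matrix would vanish modulo p, making the quaternion divisible by p. *)
Lemma scaled_norm_indivisible (p : nat) (u v w : int) :
  prime p -> odd p -> ~~ (p%:Z %| u)%Z ->
  exists x y z : int, x ^+ 2 + y ^+ 2 + z ^+ 2 = p%:Z ^+ 2 * (u ^+ 2 + v ^+ 2 + w ^+ 2) /\
    ~~ [&& (p%:Z %| x)%Z, (p%:Z %| y)%Z & (p%:Z %| z)%Z].
Proof.
move=> p_pr p_odd pu; apply: contrapT => none.
have dvd_all (x y z : int) :
    x ^+ 2 + y ^+ 2 + z ^+ 2 = p%:Z ^+ 2 * (u ^+ 2 + v ^+ 2 + w ^+ 2) ->
    [/\ (p%:Z %| x)%Z, (p%:Z %| y)%Z & (p%:Z %| z)%Z].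
  move=> e; apply/and3P/negPn/negP => h; apply: none.
  by exists x, y, z.
have [q0 [q1 [q2 [q3 eq]]]] := prime_four_squares p_pr p_odd.
(* The [m1], [m2], [m3] are the diagonal of the matrix of conjugation by q; [f1], [f2], [f3] are the
   coordinates of the image of (x, y, z). *)
pose m1 := q0 ^+ 2 + q1 ^+ 2 - q2 ^+ 2 - q3 ^+ 2.
pose m2 := q0 ^+ 2 - q1 ^+ 2 + q2 ^+ 2 - q3 ^+ 2.
pose m3 := q0 ^+ 2 - q1 ^+ 2 - q2 ^+ 2 + q3 ^+ 2.
pose f1 x y z := m1 * x + 2 * (q1 * q2 - q0 * q3) * y + 2 * (q1 * q3 + q0 * q2) * z.
pose f2 x y z := 2 * (q1 * q2 + q0 * q3) * x + m2 * y + 2 * (q2 * q3 - q0 * q1) * z.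
pose f3 x y z := 2 * (q1 * q3 - q0 * q2) * x + 2 * (q2 * q3 + q0 * q1) * y + m3 * z.
have rot x y z : x ^+ 2 + y ^+ 2 + z ^+ 2 = u ^+ 2 + v ^+ 2 + w ^+ 2 ->
    [/\ (p%:Z %| f1 x y z)%Z, (p%:Z %| f2 x y z)%Z & (p%:Z %| f3 x y z)%Z].
  by move=> e; apply: dvd_all; rewrite -e -eq /f1 /f2 /f3 /m1 /m2 /m3; ring.
have cancel m : (p%:Z %| 2 * u * m)%Z -> (p%:Z %| m)%Z.
  by rewrite !dvdz_primeM // (negbTE (ndvdz2 p_pr p_odd)) (negbTE pu).
have d1 : (p%:Z %| m1)%Z.
  have [h _ _] := rot u v w erefl.
  have [h' _ _] := rot (- u) v w ltac:(by ring).
  by apply: cancel; rewrite (_ : _ * _ = f1 u v w - f1 (- u) v w) ?rpredB // /f1; ring.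
have d2 : (p%:Z %| m2)%Z.
  have [_ h _] := rot v u w ltac:(by ring).
  have [_ h' _] := rot v (- u) w ltac:(by ring).
  by apply: cancel; rewrite (_ : _ * _ = f2 v u w - f2 v (- u) w) ?rpredB // /f2; ring.
have d3 : (p%:Z %| m3)%Z.
  have [_ _ h] := rot w v u ltac:(by ring).
  have [_ _ h'] := rot w v (- u) ltac:(by ring).
  by apply: cancel; rewrite (_ : _ * _ = f3 w v u - f3 w v (- u)) ?rpredB // /f3; ring.
have dq q : (p%:Z %| 2 * (2 * (q * q)))%Z -> (p%:Z %| q)%Z.
  by rewrite !dvdz_primeM // (negbTE (ndvdz2 p_pr p_odd)) /= orbb.
have dvd_sum x y z : (p%:Z %| x)%Z -> (p%:Z %| y)%Z -> (p%:Z %| z)%Z ->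
    (p%:Z %| p%:Z + x + y + z)%Z.
  by move=> *; rewrite !rpredD.
have [n1 n2 n3] : [/\ (p%:Z %| - m1)%Z, (p%:Z %| - m2)%Z & (p%:Z %| - m3)%Z].
  by rewrite !rpredN.
(* As q has norm p, p + m1 + m2 + m3 = 4 q0^2; flipping the signs of two diagonal entries yields 4
   q1^2, 4 q2^2 and 4 q3^2 in the same way. *)
have g0 : (p%:Z %| q0)%Z.
  by apply: dq; have := dvd_sum _ _ _ d1 d2 d3; congr (_ %| _)%Z; rewrite -eq /m1 /m2 /m3; ring.
have g1 : (p%:Z %| q1)%Z.
  by apply: dq; have := dvd_sum _ _ _ d1 n2 n3; congr (_ %| _)%Z; rewrite -eq /m1 /m2 /m3; ring.
have g2 : (p%:Z %| q2)%Z.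
  by apply: dq; have := dvd_sum _ _ _ n1 d2 n3; congr (_ %| _)%Z; rewrite -eq /m1 /m2 /m3; ring.
have g3 : (p%:Z %| q3)%Z.
  by apply: dq; have := dvd_sum _ _ _ n1 n2 d3; congr (_ %| _)%Z; rewrite -eq /m1 /m2 /m3; ring.
have : (p%:Z * p%:Z %| p%:Z)%Z.
  by rewrite -[X in (_ %| X)%Z]eq !rpredD // expr2 dvdz_mul.
rewrite dvdzE abszM /= -[X in (_ %| X)%N]muln1 dvdn_pmul2l ?prime_gt0 // dvdn1.
by move=> /eqP p1; rewrite p1 in p_pr.
Qed.

Definition triple (a b c : nat) (k : 'I_3) : nat := nth 0%N [:: a; b; c] k.

(** Sorting the absolute values of the coordinates gives an ordered representation of [t], which
    uniqueness identifies with (a, b, c). *)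
Lemma unique_rep_perm (t a b c : nat) (v : 'I_3 -> int) :
  unique_rep t a b c -> \sum_(j < 3) v j ^+ 2 = t%:Z ->
  exists s : 'S_3, forall j, `|v j|%N = triple a b c (s j).
Proof.
move=> uni vt.
pose T : 3.-tuple nat := [tuple `|v j|%N | j < 3].
have pT : perm_eq (sort leq T) T by rewrite perm_sort.
have sqT : (\sum_(x <- sort leq T) x ^ 2 = t)%N.
  rewrite (perm_big _ pT) /= big_map big_enum /=.
  apply: (can_inj absz_nat); rewrite -vt (big_morph Posz PoszD (erefl _)).
  by apply: eq_bigr => j _; rewrite -abszX gez0_abs ?sqr_ge0.
have srt : sorted leq (sort leq T) by apply: sort_sorted leq_total _.
have sz : size (sort leq T) = 3 by rewrite size_sort size_tuple.
have sE : sort leq T = [:: a; b; c].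
  move: sz sqT srt; case: (sort leq T) => [|x [|y [|z [|//]]]] //= _.
  rewrite !big_cons big_nil addn0 addnA andbT => e xyz.
  by case: (uni x y z xyz e) => -> -> ->.
have /tuple_permP[s sP] : perm_eq T [tuple a; b; c] by rewrite perm_sym /= -sE.
exists s => j.
have := congr1 (fun l => nth 0%N l j) sP.
rewrite /= (nth_map j) ?size_enum_ord // nth_ord_enum => ->.
by rewrite (nth_map j) ?size_enum_ord // nth_ord_enum (tnth_nth 0%N).
Qed.

Lemma unique_rep_primitive (t a b c : nat) :
  (t %% 4 = 2)%N -> (a ^ 2 + b ^ 2 + c ^ 2 = t)%N -> unique_rep t a b c ->
  gcdn a (gcdn b c) = 1%N.
Proof.
move=> t2 e uni; set g := gcdn a (gcdn b c).
have t_gt0 : (0 < t)%N by case: (t) t2.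
have g_gt0 : (0 < g)%N.
  rewrite lt0n; apply/eqP => /eqP; rewrite -dvd0n !dvdn_gcd !dvd0n.
  by move=> /and3P[/eqP a0 /eqP b0 /eqP c0]; move: t_gt0; rewrite -e a0 b0 c0.
have [ga gb gc] : [/\ g %| a, g %| b & g %| c]%N.
  by apply/and3P; rewrite -!dvdn_gcd.
apply/eqP; case: (ltngtP g 1%N) => // [|g_gt1]; first by rewrite ltnNge g_gt0.
have pg := pdiv_dvd g; have p_pr := pdiv_prime g_gt1; set p := pdiv g in pg p_pr.
(* If p were 2, then 4 would divide t. *)
have p_odd : odd p.
  apply: contraPT t2 => p_even; have p2 : p = 2 by case: (even_prime p_pr) p_even => // ->.
  rewrite p2 in pg.
  have : (2 * 2 %| t)%N by rewrite -e !dvdn_add // expnS expn1 dvdn_mul // (dvdn_trans pg).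
  by rewrite /dvdn => /eqP ->.
case/dvdnP: (pg) => h gE.
have h_gt0 : (0 < h)%N by case: (h) gE g_gt0 => // ->.
(* Every representation of t is divisible by g, as it is a signed permutation of (a, b, c). *)
have dvd_rep (x y z : int) : x ^+ 2 + y ^+ 2 + z ^+ 2 = t%:Z ->
    [/\ (g%:Z %| x)%Z, (g%:Z %| y)%Z & (g%:Z %| z)%Z].
  move=> exyz; pose v (j : 'I_3) : int := nth 0 [:: x; y; z] j.
  have [|s vs] := @unique_rep_perm t a b c v uni.
    by rewrite !big_ord_recl big_ord0 /= addr0 addrA.
  have gv j : (g%:Z %| v j)%Z.
    by rewrite dvdzE /= vs /triple; case: (s j) => -[|[|[|//]]].
  by split; [apply: (gv ord0) | apply: (gv (@Ordinal 3 1 isT)) | apply: (gv (@Ordinal 3 2 isT))].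
case/dvdnP: (ga) (gb) (gc) => a0 aE /dvdnP[b0 bE] /dvdnP[c0 cE].
(* Otherwise some vector of norm p^2 (u^2 + v^2 + w^2) is not divisible by p. Scaled by h = g / p it
   has norm t, yet it is not divisible by g. *)
have key (u v w : nat) : (a0 ^ 2 + b0 ^ 2 + c0 ^ 2 = u ^ 2 + v ^ 2 + w ^ 2)%N -> (p %| u)%N.
  move=> euvw; apply/negPn/negP => pu.
  have [|x [y [z [exyz]]]] := @scaled_norm_indivisible p u%:Z v%:Z w%:Z p_pr p_odd.
    by rewrite dvdzE.
  case/negP.
  have [|gx gy gz] := dvd_rep (h%:Z * x) (h%:Z * y) (h%:Z * z).
    rewrite !exprMn -!mulrDr exyz.
    have -> : t = (h ^ 2 * (p ^ 2 * (u ^ 2 + v ^ 2 + w ^ 2)))%N.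
      by rewrite -euvw -e aE bE cE gE; ring.
    by rewrite -!mulnn !(PoszM, PoszD) !expr2.
  have cancel (r : int) : (g%:Z %| h%:Z * r)%Z -> (p%:Z %| r)%Z.
    by rewrite gE !dvdzE abszM /= dvdn_pmul2l.
  by apply/and3P; split; apply: cancel.
have : (p * g %| g)%N.
  rewrite {2}/g !dvdn_gcd; apply/and3P; split.
  - by rewrite aE dvdn_mul // (key a0 b0 c0).
  - by rewrite bE dvdn_mul // (key b0 a0 c0) //; lia.
  - by rewrite cE dvdn_mul // (key c0 a0 b0) //; lia.
rewrite -[X in (_ %| X)%N]mul1n dvdn_pmul2r // dvdn1.
by move=> /eqP p1; rewrite p1 in p_pr.
Qed.

(** * Sums of even and odd length; existence of an odd configuration *)

Definition sqnorm3 (u : int * int * int) : int := u.1.1 ^+ 2 + u.1.2 ^+ 2 + u.2 ^+ 2.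

(** Recording only the parity of the length makes the case [e = false] a subgroup of Z^3, where
    Bezout combinations are available. *)
Definition parity_sum (t : nat) (e : bool) (u : int * int * int) : Prop :=
  exists s : seq (int * int * int),
    [/\ all (fun w => sqnorm3 w == t%:Z) s, odd (size s) = e & \sum_(w <- s) w = u].

Lemma parity_sum0 t : parity_sum t false 0.
Proof. by exists [::]; rewrite big_nil. Qed.

Lemma parity_sum1 t x y z : x ^+ 2 + y ^+ 2 + z ^+ 2 = t%:Z ->
  parity_sum t true (x, y, z).
Proof. by move=> e; exists [:: (x, y, z)]; rewrite big_seq1 /sqnorm3 /= e eqxx. Qed.

Lemma parity_sumD t e e' u u' : parity_sum t e u -> parity_sum t e' u' ->
  parity_sum t (e (+) e') (u + u').
Proof.
move=> [s [s1 s2 s3]] [r [r1 r2 r3]]; exists (s ++ r); split.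
- by rewrite all_cat s1 r1.
- by rewrite size_cat oddD s2 r2.
- by rewrite big_cat s3 r3.
Qed.

Lemma parity_sumN t e u : parity_sum t e u -> parity_sum t e (- u).
Proof.
move=> [s [s1 s2 s3]]; exists [seq - w | w <- s]; split.
- rewrite all_map; apply: sub_all s1 => w /=.
  by rewrite /sqnorm3 /= !sqrrN.
- by rewrite size_map.
- by rewrite big_map sumrN s3.
Qed.

Lemma parity_sumMz t x y z (k : int) : parity_sum t false (x, y, z) ->
  parity_sum t false (x * k, y * k, z * k).
Proof.
move=> hu; have hn (n : nat) : parity_sum t false (x * n%:Z, y * n%:Z, z * n%:Z).
  elim: n => [|n IHn]; first by rewrite !mulr0; apply: parity_sum0.
  rewrite -(addbb false) (_ : (_, _, _) = (x, y, z) + (x * n%:Z, y * n%:Z, z * n%:Z)).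
    exact: parity_sumD.
  by congr (_, _, _); rewrite intS mulrDr mulr1.
by case: k => n //; rewrite NegzE !mulrN; apply: (parity_sumN (hn n.+1)).
Qed.

Lemma zero_sum_config_of_parity t : parity_sum t true 0 ->
  exists2 n, odd n & zero_sum_config 3 t n.
Proof.
move=> [s [/allP s1 s2 s3]]; exists (size s) => //.
pose f (u : int * int * int) (j : 'I_3) : int := nth 0 [:: u.1.1; u.1.2; u.2] j.
exists (fun i j => f (nth 0 s i) j); split=> [i|j].
  have /s1/eqP <- : nth 0 s i \in s by rewrite mem_nth.
  by rewrite !big_ord_recl big_ord0 /= addr0 addrA.
rewrite -(big_mkord xpredT (fun i => f (nth 0 s i) j)) -(big_nth 0 xpredT (fun u => f u j)).
have fD : {morph f^~ j : u w / u + w >-> u + w}.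
  by move=> u w; rewrite /f; case: (j) => -[|[|[|//]]].
have f0 : f 0 j = 0 by rewrite /f; case: (j) => -[|[|[|//]]].
by rewrite -(big_morph _ fD f0) s3.
Qed.

Lemma bezout3 (a b c : nat) : gcdn a (gcdn b c) = 1%N ->
  exists u v w : int, a%:Z * u + b%:Z * v + c%:Z * w = 1.
Proof.
move=> g1; have [u1 [v1 e1]] := Bezoutz a%:Z (gcdz b%:Z c%:Z).
have [u2 [v2 e2]] := Bezoutz b%:Z c%:Z.
exists u1, (v1 * u2), (v1 * v2).
by rewrite -[RHS]/(Posz 1) -g1 -[RHS]/(gcdz a%:Z (gcdz b%:Z c%:Z)) -e1 -e2; ring.
Qed.

Lemma odd_config_exists (t a b c : nat) : (t %% 4 = 2)%N ->
  (a ^ 2 + b ^ 2 + c ^ 2 = t)%N -> gcdn a (gcdn b c) = 1%N ->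
  exists n, odd_config 3 t n.
Proof.
move=> t2 e g1.
suff /zero_sum_config_of_parity[n n_odd cfg] : parity_sum t true 0.
  by exists n; rewrite /odd_config n_odd; apply/asboolP.
have ez : a%:Z ^+ 2 + b%:Z ^+ 2 + c%:Z ^+ 2 = t%:Z.
  by rewrite -e !PoszD -!mulnn !PoszM !expr2.
have two x y z : x ^+ 2 + y ^+ 2 + z ^+ 2 = t%:Z ->
    [/\ parity_sum t false (2 * x, 0, 0), parity_sum t false (0, 2 * x, 0)
      & parity_sum t false (0, 0, 2 * x)].
  move=> exyz; split.
  - rewrite (_ : (_, _, _) = (x, y, z) + (x, - y, - z)).
      by rewrite -(addbb true); apply: parity_sumD; apply: parity_sum1; rewrite -exyz; ring.
    by congr (_, _, _) => /=; ring.
  - rewrite (_ : (_, _, _) = (y, x, z) + (- y, x, - z)).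
      by rewrite -(addbb true); apply: parity_sumD; apply: parity_sum1; rewrite -exyz; ring.
    by congr (_, _, _) => /=; ring.
  - rewrite (_ : (_, _, _) = (y, z, x) + (- y, - z, x)).
      by rewrite -(addbb true); apply: parity_sumD; apply: parity_sum1; rewrite -exyz; ring.
    by congr (_, _, _) => /=; ring.
have [a1 a2 a3] := two _ _ _ ez.
have [b1 b2 b3] := two b%:Z a%:Z c%:Z ltac:(by rewrite -ez; ring).
have [c1 c2 c3] := two c%:Z a%:Z b%:Z ltac:(by rewrite -ez; ring).
(* Each square has the parity of its root, and t is even. *)
have [h eh] : exists h : int, a%:Z + b%:Z + c%:Z = 2 * h.
  exists (Posz (a + b + c)./2); rewrite -!PoszD -[2]/(Posz 2) -PoszM mul2n even_halfK //.
  have : ~~ odd t by rewrite -(odd_mod t (d := 4)) // t2.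
  by rewrite -e !oddD !oddX.
have [u [v [w bez]]] := bezout3 g1.
(* By Bezout, these multiples of 2a, 2b, 2c add up to -2h = -(a + b + c), which cancels one
   coordinate of the sum of the three cyclic shifts. *)
have comb x1 y1 z1 x2 y2 z2 x3 y3 z3 : parity_sum t false (x1, y1, z1) ->
    parity_sum t false (x2, y2, z2) -> parity_sum t false (x3, y3, z3) ->
    parity_sum t false ((x1 * (- h * u), y1 * (- h * u), z1 * (- h * u))
      + (x2 * (- h * v), y2 * (- h * v), z2 * (- h * v))
      + (x3 * (- h * w), y3 * (- h * w), z3 * (- h * w))).
  move=> p1 p2 p3; apply: (parity_sumD (e := false) (e' := false)).
    by apply: (parity_sumD (e := false) (e' := false)); apply: parity_sumMz.
  exact: parity_sumMz.
have r1 := parity_sum1 ez.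
have r2 : parity_sum t true (b%:Z, c%:Z, a%:Z) by apply: parity_sum1; rewrite -ez; ring.
have r3 : parity_sum t true (c%:Z, a%:Z, b%:Z) by apply: parity_sum1; rewrite -ez; ring.
have := parity_sumD (parity_sumD (parity_sumD (comb _ _ _ _ _ _ _ _ _ a1 b1 c1)
  (comb _ _ _ _ _ _ _ _ _ a2 b2 c2))
  (comb _ _ _ _ _ _ _ _ _ a3 b3 c3)) (parity_sumD (parity_sumD r1 r2) r3).
congr parity_sum.
have hs : 2 * h * (a%:Z * u + b%:Z * v + c%:Z * w) = a%:Z + b%:Z + c%:Z.
  by rewrite bez eh mulr1.
have abc0 : a%:Z + b%:Z + c%:Z - 2 * h * (a%:Z * u + b%:Z * v + c%:Z * w) = 0.
  by rewrite hs subrr.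
by congr (_, _, _) => /=; rewrite -[RHS]abc0; ring.
Qed.

(** * The form x^2 + x y + y^2 modulo primes p = 2 mod 3 *)

(** A zero of the form satisfies x^3 = y^3. Fermat's little theorem makes cubing injective for such
    p, so nonzero x and y would be equal, and 3 x^2 = 0 with p different from 3. *)
Lemma Fp_eisenstein_form_eq0 (p : nat) (x y : 'F_p) : prime p -> (p %% 3 = 2)%N ->
  x ^+ 2 + x * y + y ^+ 2 = 0 -> x = 0 /\ y = 0.
Proof.
move=> p_pr p3 e.
have pE : p = (2 + 3 * (p %/ 3))%N by lia.
have frob (z : 'F_p) : z = z ^+ 2 * (z ^+ 3) ^+ (p %/ 3).
  by have := expf_card z; rewrite card_Fp // -exprM -exprD -pE.
have xy3 : x ^+ 3 = y ^+ 3.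
  apply/eqP; rewrite -subr_eq0; apply/eqP.
  by rewrite -[RHS](mulr0 (x - y)) -e; ring.
(* By [frob], both x y^2 and y x^2 equal x^2 y^2 (x^3)^(p %/ 3). *)
have /eqP : x * y * (y - x) = 0.
  have -> : x * y * (y - x) = x * y ^+ 2 - y * x ^+ 2 by ring.
  by rewrite {1}[x]frob {2}[y]frob xy3; ring.
rewrite !mulf_eq0 subr_eq0 => /orP[/orP[]|] /eqP z.
- move: e; rewrite z expr0n mul0r !add0r => /eqP.
  by rewrite sqrf_eq0 => /eqP.
- move: e; rewrite z expr0n mulr0 !addr0 => /eqP.
  by rewrite sqrf_eq0 => /eqP.
have /eqP : 3%:R * x ^+ 2 = 0 :> 'F_p by rewrite -e z; ring.
rewrite mulf_eq0 sqrf_eq0 z => /orP[|/eqP -> //].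
rewrite -(dvdn_pcharf (pchar_Fp p_pr)) dvdn_prime2 // => /eqP p_eq3.
by rewrite p_eq3 in p3.
Qed.

Lemma dvdz_eisenstein_form (p : nat) (x y : int) : prime p -> (p %% 3 = 2)%N ->
  (p%:Z %| x ^+ 2 + x * y + y ^+ 2)%Z -> (p%:Z %| x)%Z /\ (p%:Z %| y)%Z.
Proof.
move=> p_pr p3; rewrite !(dvdz_pcharf (pchar_Fp p_pr)).
rewrite !rmorphD !rmorphM /= => /eqP e.
have [|-> ->] := @Fp_eisenstein_form_eq0 p x%:~R y%:~R p_pr p3; last by rewrite eqxx.
by rewrite -[RHS]e; ring.
Qed.

(** * Linear relations and rank-one matrices *)

(** The cross product of two vectors orthogonal to the primitive (a, b, c) is an integer multiple
    [l] of it, where [l] is its inner product with the Bezout vector (u, v, w). Either [l] is 0 or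
    its absolute value is at least 1. *)
Lemma orthogonal_pair_dichotomy (x1 x2 x3 y1 y2 y3 a b c u v w : int) :
  a * u + b * v + c * w = 1 ->
  x1 * a + x2 * b + x3 * c = 0 -> y1 * a + y2 * b + y3 * c = 0 ->
  [/\ x2 * y3 = x3 * y2, x3 * y1 = x1 * y3 & x1 * y2 = x2 * y1] \/
  [/\ `|a| <= `|x2 * y3 - x3 * y2|, `|b| <= `|x3 * y1 - x1 * y3| &
      `|c| <= `|x1 * y2 - x2 * y1|].
Proof.
move=> bez ex ey.
set n1 := x2 * y3 - x3 * y2; set n2 := x3 * y1 - x1 * y3; set n3 := x1 * y2 - x2 * y1.
have e12 : n1 * b = n2 * a.
  apply/eqP; rewrite -subr_eq0; apply/eqP.
  have -> : n1 * b - n2 * a = y3 * (x1 * a + x2 * b + x3 * c) - x3 * (y1 * a + y2 * b + y3 * c).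
    by rewrite /n1 /n2; ring.
  by rewrite ex ey !mulr0 subrr.
have e13 : n1 * c = n3 * a.
  apply/eqP; rewrite -subr_eq0; apply/eqP.
  have -> : n1 * c - n3 * a = x2 * (y1 * a + y2 * b + y3 * c) - y2 * (x1 * a + x2 * b + x3 * c).
    by rewrite /n1 /n3; ring.
  by rewrite ex ey !mulr0 subrr.
have e23 : n2 * c = n3 * b.
  apply/eqP; rewrite -subr_eq0; apply/eqP.
  have -> : n2 * c - n3 * b = y1 * (x1 * a + x2 * b + x3 * c) - x1 * (y1 * a + y2 * b + y3 * c).
    by rewrite /n2 /n3; ring.
  by rewrite ex ey !mulr0 subrr.
pose l := n1 * u + n2 * v + n3 * w.
have l1 : n1 = l * a.
  rewrite -[LHS]mulr1 -bez !mulrDr !mulrA e12 e13 /l; ring.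
have l2 : n2 = l * b.
  rewrite -[LHS]mulr1 -bez !mulrDr !mulrA -e12 e23 /l; ring.
have l3 : n3 = l * c.
  rewrite -[LHS]mulr1 -bez !mulrDr !mulrA -e13 -e23 /l; ring.
have [l0|l_neq0] := eqVneq l 0.
  by left; split; apply/eqP; rewrite -subr_eq0; apply/eqP;
    rewrite -?/n1 -?/n2 -?/n3 ?l1 ?l2 ?l3 l0 mul0r.
have l_ge1 : 1 <= `|l| by rewrite -gtz0_ge1 normr_gt0.
by right; rewrite l1 l2 l3 !normrM !ler_peMl.
Qed.

(** An odd x >= 3 would force x = 3, x' = 1 and y <= 2, whereas x y' >= 3. *)
Lemma odd_entry_eq1 (x x' y y' : nat) : odd x -> odd x' -> odd y' ->
  (x + x' <= 5)%N -> (x + y <= 5)%N -> (x * y' = x' * y)%N -> x = 1%N.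
Proof.
by case: x => [|[|[|[|[|[|x]]]]]] //=; lia.
Qed.

Lemma leq_two_sum (I : finType) (F : I -> nat) (i j : I) : i != j ->
  (F i + F j <= \sum_k F k)%N.
Proof. by move=> nij; rewrite (bigD1 i) //= (bigD1 j) 1?eq_sym //= addnA leq_addr. Qed.

(* A rank-one integer matrix whose row and column sums are all odd has only odd entries. *)
Lemma rank1_unit_entries (M : 'I_3 -> 'I_3 -> int) :
  (forall j j' k k', M j k * M j' k' = M j k' * M j' k) ->
  (forall j, odd `|\sum_k M j k|) -> (forall k, odd `|\sum_j M j k|) ->
  (forall j, \sum_k `|M j k| <= 5)%N -> (forall k, \sum_j `|M j k| <= 5)%N ->
  forall j k, `|M j k|%N = 1%N.
Proof.
move=> rk1 oddR oddC leR leC.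
have odd_entry j k : odd `|M j k|.
  (* Rank one turns an entry times the total sum into its row sum times its column sum, a product of
     odd numbers. *)
  have : odd `|M j k * \sum_j' \sum_k' M j' k'|.
    rewrite (_ : _ * _ = (\sum_k' M j k') * (\sum_j' M j' k)).
      by rewrite abszM oddM oddR oddC.
    rewrite mulr_sumr [RHS]mulr_sumr; apply: eq_bigr => j' _.
    by rewrite mulr_sumr mulr_suml; apply: eq_bigr => k' _; apply: rk1.
  by rewrite abszM oddM => /andP[].
have other (i : 'I_3) : exists i' : 'I_3, i != i'.
  by exists (if i == ord0 then ord_max else ord0); case: (eqVneq i ord0) => [->|].
move=> j k; have [[j' nj] [k' nk]] := (other j, other k).
apply: (@odd_entry_eq1 _ `|M j k'| `|M j' k| `|M j' k'|); rewrite ?odd_entry //.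
- exact: leq_trans (leq_two_sum (fun k => `|M j k|%N) nk) (leR j).
- exact: leq_trans (leq_two_sum (fun j => `|M j k|%N) nj) (leC k).
- by rewrite -!abszM rk1.
Qed.

Lemma leq_absz_sum (I : finType) (F : I -> int) : (`|(\sum_i F i)%R| <= \sum_i `|F i|)%N.
Proof.
by elim/big_ind2: _ => // *; lia.
Qed.

Lemma absz1_cases (f : int) : `|f|%N = 1%N -> f = 1 \/ f = -1.
Proof. by lia. Qed.

Lemma odd_abszD_sign (x f : int) : `|f|%N = 1%N -> odd `|x + f| = ~~ odd `|x|.
Proof. by move=> /absz1_cases[] ->; lia. Qed.

Lemma odd_absz_sum_signs (n : nat) (F : 'I_n -> int) :
  (forall i, `|F i|%N = 1%N) -> odd `|\sum_i F i| = odd n.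
Proof.
elim: n F => [|n IHn] F hF; first by rewrite big_ord0.
rewrite big_ord_recr /= -(IHn (fun i => F (widen_ord (leqnSn n) i))) //.
exact: odd_abszD_sign.
Qed.

(** * The coefficient matrix of a configuration *)

(** Zero gets the sign 1, so that zero coordinates also count in the parity arguments. *)
Definition sgn1 (x : int) : int := if x < 0 then -1 else 1.

Lemma absz_sgn1 x : `|sgn1 x|%N = 1%N.
Proof. by rewrite /sgn1; case: ifP. Qed.

Lemma sgn1_mul_absz x : x = sgn1 x * `|x|%N%:Z.
Proof. by rewrite /sgn1; case: ifP; lia. Qed.

(* Coefficient of the k-th entry of the unique representation in the j-th
   coordinate of the sum of the vectors v i. *)
Definition config_coef (n : nat) (v : 'I_n -> 'I_3 -> int) (s : 'I_n -> 'S_3)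
    (j k : 'I_3) : int :=
  \sum_(i < n) (if s i j == k then sgn1 (v i j) else 0).

Section ConfigCoef.
Variables (n : nat) (v : 'I_n -> 'I_3 -> int) (s : 'I_n -> 'S_3) (w : 'I_3 -> nat).
Hypothesis vE : forall i j, `|v i j|%N = w (s i j).
Let M := config_coef v s.

Lemma config_coef_col j : \sum_k M j k * (w k)%:Z = \sum_i v i j.
Proof.
under eq_bigr => k _ do rewrite mulr_suml.
rewrite exchange_big /=; apply: eq_bigr => i _.
rewrite (bigD1 (s i j)) //= eqxx big1 ?addr0 => [|k /negbTE nk].
  by rewrite -vE -sgn1_mul_absz.
by rewrite eq_sym nk mul0r.
Qed.

(** Each vector contributes one sign to every row and, [s i] being a permutation, one sign to every
    column. Row and column sums thus have the parity of [n]. *)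
Lemma config_coef_sum_var j : \sum_k M j k = \sum_i sgn1 (v i j).
Proof.
rewrite exchange_big /=; apply: eq_bigr => i _.
by rewrite (bigD1 (s i j)) //= eqxx big1 ?addr0 // => k /negbTE nk; rewrite eq_sym nk.
Qed.

Lemma config_coef_sum_coord k : \sum_j M j k = \sum_i sgn1 (v i ((s i)^-1%g k)).
Proof.
rewrite exchange_big /=; apply: eq_bigr => i _.
rewrite (bigD1 ((s i)^-1%g k)) //= permKV eqxx big1 ?addr0 // => j nj.
by rewrite (canF_eq (permK (s i))) (negbTE nj).
Qed.

Lemma leq_config_coef j k : (`|M j k| <= \sum_(i < n) (s i j == k))%N.
Proof.
apply: leq_trans (leq_absz_sum _) _; apply: leq_sum => i _.
by case: eqP; rewrite ?absz_sgn1.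
Qed.

Lemma config_coef_norm_var j : (\sum_k `|M j k| <= n)%N.
Proof.
apply: (@leq_trans (\sum_k \sum_(i < n) (s i j == k))%N).
  by apply: leq_sum => k _; apply: leq_config_coef.
rewrite exchange_big /= -[X in (_ <= X)%N]card_ord -sum1_card; apply: leq_sum => i _.
by rewrite (bigD1 (s i j)) //= eqxx big1 // => k /negbTE nk; rewrite eq_sym nk.
Qed.

Lemma config_coef_norm_coord k : (\sum_j `|M j k| <= n)%N.
Proof.
apply: (@leq_trans (\sum_j \sum_(i < n) (s i j == k))%N).
  by apply: leq_sum => j _; apply: leq_config_coef.
rewrite exchange_big /= -[X in (_ <= X)%N]card_ord -sum1_card; apply: leq_sum => i _.
rewrite (bigD1 ((s i)^-1%g k)) //= permKV eqxx big1 // => j nj.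
by rewrite (canF_eq (permK (s i))) (negbTE nj).
Qed.

End ConfigCoef.

(** * Configurations of at most five vectors *)

Lemma norm_minor_le50 (x y z w : int) : `|x| <= 5 -> `|y| <= 5 -> `|z| <= 5 -> `|w| <= 5 ->
  `|x * y - z * w| <= 50.
Proof.
move=> hx hy hz hw; apply: le_trans (ler_normB _ _) _; rewrite !normrM.
by rewrite (_ : 50 = 5 * 5 + 5 * 5) ?lerD ?ler_pM.
Qed.

Lemma zero_sum_small_or_linear (n t a b c : nat) :
  odd n -> (n <= 5)%N -> unique_rep t a b c ->
  gcdn a (gcdn b c) = 1%N -> zero_sum_config 3 t n ->
  [/\ a <= 50, b <= 50 & c <= 50]%N \/
  exists e1 e2 e3 : int, [/\ `|e1|%N = 1%N, `|e2|%N = 1%N, `|e3|%N = 1%N &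
    e1 * a%:Z + e2 * b%:Z + e3 * c%:Z = 0].
Proof.
move=> n_odd n5 uni g1 [v [vt v0]].
have [s vE] := choice (fun i => unique_rep_perm uni (vt i)).
pose M := config_coef v s; pose k0 : 'I_3 := ord0.
pose k1 : 'I_3 := @Ordinal 3 1 isT; pose k2 : 'I_3 := @Ordinal 3 2 isT.
have ord3 (P : 'I_3 -> Prop) : P k0 -> P k1 -> P k2 -> forall k, P k.
  move=> P0 P1 P2 [[|[|[|//]]] hk]; first by rewrite (_ : Ordinal hk = k0) //; apply: val_inj.
    by rewrite (_ : Ordinal hk = k1) //; apply: val_inj.
  by rewrite (_ : Ordinal hk = k2) //; apply: val_inj.
have [u1 [u2 [u3 bez]]] := bezout3 g1.
have col j : M j k0 * a%:Z + M j k1 * b%:Z + M j k2 * c%:Z = 0.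
  rewrite -(v0 j) -(config_coef_col vE) !big_ord_recl big_ord0 addr0 addrA.
  by congr (_ * _ + _ * _ + _ * _); congr (M j _); apply: val_inj.
have rowM j : (\sum_k `|M j k| <= 5)%N by apply: leq_trans (config_coef_norm_var _ _ _) n5.
have colM k : (\sum_j `|M j k| <= 5)%N by apply: leq_trans (config_coef_norm_coord _ _ _) n5.
have M5 j k : `|M j k| <= 5.
  by rewrite -abszE lez_nat; apply: leq_trans (leq_term_sum (fun k => `|M j k|%N) k) (rowM j).
have [small|nsmall] := pselect [/\ a <= 50, b <= 50 & c <= 50]%N; [by left | right].
(* Two independent rows would bound a, b and c by minors of size at most 50. *)
have rk1 j j' k k' : M j k * M j' k' = M j k' * M j' k.
  have [|[ha hb hc]] := orthogonal_pair_dichotomy bez (col j) (col j').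
    case=> m12 m20 m01; elim/ord3: k k' => [||]; elim/ord3 => [||]; lia.
  case: nsmall; split; rewrite -lez_nat -[X in X <= _]ger0_norm //.
  - exact: le_trans ha (norm_minor_le50 _ _ _ _).
  - exact: le_trans hb (norm_minor_le50 _ _ _ _).
  - exact: le_trans hc (norm_minor_le50 _ _ _ _).
have unitM : forall j k, `|M j k|%N = 1%N.
  apply: rank1_unit_entries => // [j|k].
    by rewrite config_coef_sum_var odd_absz_sum_signs // => i; apply: absz_sgn1.
  by rewrite config_coef_sum_coord odd_absz_sum_signs // => i; apply: absz_sgn1.
by exists (M k0 k0), (M k0 k1), (M k0 k2).
Qed.

Lemma dvdn_of_linear_relation (p a b c t : nat) (e1 e2 e3 : int) :
  prime p -> odd p -> (p %% 3 = 2)%N -> (p %| t)%N -> (a ^ 2 + b ^ 2 + c ^ 2 = t)%N ->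
  `|e1|%N = 1%N -> `|e2|%N = 1%N -> `|e3|%N = 1%N ->
  e1 * a%:Z + e2 * b%:Z + e3 * c%:Z = 0 -> [/\ p %| a, p %| b & p %| c]%N.
Proof.
move=> p_pr p_odd p3 pt e h1 h2 h3 rel.
have sq (f : int) (m : nat) : `|f|%N = 1%N -> (f * m%:Z) ^+ 2 = (m ^ 2)%N%:Z.
  move=> hf; rewrite exprMn (_ : f ^+ 2 = 1); last by case/absz1_cases: hf => ->; ring.
  by rewrite mul1r -mulnn PoszM expr2.
set A := e1 * a%:Z in rel; set B := e2 * b%:Z in rel; set D := e3 * c%:Z in rel.
have DE : D = - (A + B) by apply/eqP; rewrite -addr_eq0 addrC rel.
have tE : t%:Z = 2 * (A ^+ 2 + A * B + B ^+ 2).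
  rewrite -e !PoszD -(sq _ _ h1) -(sq _ _ h2) -(sq _ _ h3) -/A -/B -/D DE; ring.
have : (p%:Z %| t%:Z)%Z by rewrite dvdzE.
rewrite tE dvdz_primeM // (negbTE (ndvdz2 p_pr p_odd)) => /(dvdz_eisenstein_form p_pr p3) [pA pB].
have pD : (p%:Z %| D)%Z by rewrite DE rpredN rpredD.
by move: pA pB pD; rewrite !dvdzE !abszM h1 h2 h3 !mul1n /= => *; split.
Qed.

Local Close Scope ring_scope.

Lemma prime_dvd_sqfree_part (p t : nat) : prime p -> p %| sqfree_part t -> p %| t.
Proof.
move=> p_pr; apply: contraTT => npt.
rewrite /sqfree_part big_seq_cond; apply: (big_ind (fun m => ~~ (p %| m))) => [|x y hx hy|q].
- by rewrite dvdn1; apply: contraTneq p_pr => ->.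
- by rewrite Euclid_dvdM // negb_or hx.
rewrite mem_primes => /andP[/and3P[q_pr _ qt] _].
by apply: contra npt => pq; apply: dvdn_trans qt.
Qed.

Theorem theorem7 (t : nat) :
  inT t -> 10 ^ 6 <= t -> P t = 1 -> 5 < C 3 t.
Proof.
move=> [_ [t2 [p [p_pr p_odd psq p3]]]] t_big Pt.
have [a [b [c [e uni]]]] := P_eq1 Pt.
have g1 := unique_rep_primitive t2 e uni.
(* [C] takes the value 0 when no odd configuration exists, so the bound requires existence first. *)
rewrite /C; case: pselect => [h|]; last by case; apply: odd_config_exists g1.
case: ex_minnP => n /andP[n_odd /asboolP cfg] _.
rewrite ltnNge; apply/negP => n5.
have [[ha hb hc]|[e1 [e2 [e3 [h1 h2 h3 rel]]]]] := zero_sum_small_or_linear n_odd n5 uni g1 cfg.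
  have : t <= 3 * 50 ^ 2.
    by rewrite -e !mulSn mul0n addn0 addnA !leq_add ?leq_exp2r.
  by move/(leq_trans t_big).
have pt := prime_dvd_sqfree_part p_pr psq.
have [pa pb pc] := dvdn_of_linear_relation p_pr p_odd p3 pt e h1 h2 h3 rel.
have : p %| gcdn a (gcdn b c) by rewrite !dvdn_gcd pa pb pc.
by rewrite g1 dvdn1 => /eqP p1; rewrite p1 in p_pr.
Qed.
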